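(* Let $X$ be a real Banach space with continuous dual $X^*$. Let $A\colon X\rightrightarrows X^*$ be a maximally monotone linear relation, and let $f\colon X\to\left]-\infty,+\infty\right]$ be a proper lower semicontinuous convex function such that $\operatorname{dom} A\cap\operatorname{int}\operatorname{dom}\partial f\neq\varnothing$. Then the sum operator $A+\partial f$ is maximally monotone.
   Context: A set-valued operator $A\colon X\rightrightarrows X^*$ has graph $\operatorname{gra}A=\{(x,x^* )\in X\times X^*: x^*\in Ax\}$ and domain $\operatorname{dom}A=\{x\in X: Ax\neq\varnothing\}$. $A$ is monotone if $\langle x-y,x^*-y^*\rangle\ge 0$ for all $(x,x^* ),(y,y^* )\in\operatorname{gra}A$, and maximally monotone if it is monotone and has no proper monotone extension (with respect to graph inclusion). $A$ is a linear relation if $\operatorname{gra}A$ is a linear subspace of $X\times X^*$. For a proper convex $f$, $\partial f(x)=\{x^*\in X^*: \langle y-x,x^*\rangle+f(x)\le f(y)\ \forall y\in X\}$ is the subdifferential. The sum is $(A+\partial f)(x)=\{a^*+b^*: a^*\in Ax,\ b^*\in\partial f(x)\}$. $\operatorname{int}$ denotes the norm interior. *)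

(* Defs.v *)
From Stdlib Require Import Reals.
Open Scope R_scope.
Set Implicit Arguments.

Record Banach := {
  carrier :> Type;
  vzero : carrier;
  vadd : carrier -> carrier -> carrier;
  vopp : carrier -> carrier;
  vscal : R -> carrier -> carrier;
  vnorm : carrier -> R;
  vadd_assoc : forall x y z, vadd x (vadd y z) = vadd (vadd x y) z;
  vadd_comm : forall x y, vadd x y = vadd y x;
  vadd_0 : forall x, vadd x vzero = x;
  vadd_opp : forall x, vadd x (vopp x) = vzero;
  vscal_1 : forall x, vscal 1 x = x;
  vscal_assoc : forall a b x, vscal a (vscal b x) = vscal (a * b) x;
  vscal_distr_v : forall a x y, vscal a (vadd x y) = vadd (vscal a x) (vscal a y);
  vscal_distr_s : forall a b x, vscal (a + b) x = vadd (vscal a x) (vscal b x);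
  vnorm_eq0 : forall x, vnorm x = 0 -> x = vzero;
  vnorm_scal : forall a x, vnorm (vscal a x) = Rabs a * vnorm x;
  vnorm_triangle : forall x y, vnorm (vadd x y) <= vnorm x + vnorm y;
  vcomplete : forall u : nat -> carrier,
    (forall eps, 0 < eps -> exists N, forall m n, (N <= m)%nat -> (N <= n)%nat ->
        vnorm (vadd (u m) (vopp (u n))) < eps) ->
    exists l, forall eps, 0 < eps -> exists N, forall n, (N <= n)%nat ->
        vnorm (vadd (u n) (vopp l)) < eps
}.

Definition vsub {X : Banach} (x y : X) : X := vadd X x (vopp X y).

Record dual (X : Banach) := {
  dfun :> X -> R;
  dfun_add : forall x y, dfun (vadd X x y) = dfun x + dfun y;
  dfun_scal : forall a x, dfun (vscal X a x) = a * dfun x;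
  dfun_bounded : exists M, forall x, Rabs (dfun x) <= M * vnorm X x
}.

Definition pairing {X : Banach} (x : X) (xs : dual X) : R := dfun xs x.

Definition operator (X : Banach) := X -> dual X -> Prop.

Definition dom_op {X : Banach} (A : operator X) (x : X) : Prop :=
  exists xs, A x xs.

Definition monotone {X : Banach} (A : operator X) : Prop :=
  forall x xs y ys, A x xs -> A y ys ->
    0 <= pairing (vsub x y) xs - pairing (vsub x y) ys.

Definition maximally_monotone {X : Banach} (A : operator X) : Prop :=
  monotone A /\
  forall B : operator X, monotone B ->
    (forall x xs, A x xs -> B x xs) -> forall x xs, B x xs -> A x xs.

(** Linear relation: the graph is a linear subspace of X × X^*
    (nonempty, closed under linear combinations; the combination of
    functionals is described pointwise). *)
Definition linear_relation {X : Banach} (A : operator X) : Prop :=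
  (exists x xs, A x xs) /\
  forall a b x xs y ys zs, A x xs -> A y ys ->
    (forall u, dfun zs u = a * dfun xs u + b * dfun ys u) ->
    A (vadd X (vscal X a x) (vscal X b y)) zs.

Inductive ereal := Fin (r : R) | PInf.

Definition ele (a b : ereal) : Prop :=
  match a, b with
  | _, PInf => True
  | PInf, Fin _ => False
  | Fin r, Fin s => r <= s
  end.

Definition elt (a b : ereal) : Prop :=
  match a, b with
  | Fin r, PInf => True
  | PInf, _ => False
  | Fin r, Fin s => r < s
  end.

Definition eadd (a b : ereal) : ereal :=
  match a, b with
  | Fin r, Fin s => Fin (r + s)
  | _, _ => PInf
  end.

Definition proper {X : Banach} (f : X -> ereal) : Prop :=
  exists x, f x <> PInf.

(** Convexity: f(tx+(1-t)y) <= t f(x) + (1-t) f(y) for 0<t<1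
    (trivial when the right-hand side is +oo). *)
Definition convex {X : Banach} (f : X -> ereal) : Prop :=
  forall x y t, 0 < t < 1 ->
    match f x, f y with
    | Fin a, Fin b =>
        ele (f (vadd X (vscal X t x) (vscal X (1 - t) y))) (Fin (t * a + (1 - t) * b))
    | _, _ => True
    end.

Definition lsc {X : Banach} (f : X -> ereal) : Prop :=
  forall x r, elt (Fin r) (f x) ->
    exists d, 0 < d /\ forall y, vnorm X (vsub y x) < d -> elt (Fin r) (f y).

Definition subdiff {X : Banach} (f : X -> ereal) : operator X :=
  fun x xs => forall y, ele (eadd (Fin (pairing (vsub y x) xs)) (f x)) (f y).

Definition norm_interior {X : Banach} (S : X -> Prop) (x : X) : Prop :=
  exists d, 0 < d /\ forall y, vnorm X (vsub y x) < d -> S y.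

Definition op_sum {X : Banach} (A B : operator X) : operator X :=
  fun x zs => exists as_ bs, A x as_ /\ B x bs /\
    forall u, dfun zs u = dfun as_ u + dfun bs u.

(* Main.v *)
Require Import Defs.
From Stdlib Require Import Reals.
From Stdlib Require Import Lra Lia List Classical FunctionalExtensionality ProofIrrelevance.
From mathcomp Require boolp classical_sets.

(** Let [(z, z')] be monotonically related to [A + subdiff f], let [x] lie in
    [dom A] and the interior of [dom f], and consider the open drop with apex [z] over a
    small ball around [x], whose points are [u = z + t (v - z)].  Inside the drop, [dom A]
    stays in the interior of [dom f]: at a first exit point [f] would be subdifferentiable
    with a normal to [dom f] pointing towards [z], and large multiples of it violate
    relatedness.  By convexity the slopes [<u - z, b>] of subgradients at [u] are at most
    [M t], so [<a - z, a' - z'> + M t >= 0] on the part of the graph of [A] over the drop.  The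
    left-hand side is convex because the graph of [A] is, so Hahn-Banach yields [y'] with
    [<a - z, a' - z' + y'> >= 0] on the whole graph; by maximality [z] is in [dom A].
    Letting [t] tend to [0] along segments from [z], [z] minimizes a linear perturbation
    of [f] over the subspace [dom A], and Hahn-Banach splits [z'] accordingly. *)

(** * Vector identities by reflection *)

Inductive vexpr :=
  | VVar (n : nat) | VZero | VAdd (a b : vexpr) | VOpp (a : vexpr)
  | VScal (r : R) (a : vexpr).

Fixpoint veval (X : Banach) (env : list X) (e : vexpr) : X :=
  match e with
  | VVar n => nth n env (vzero X)
  | VZero => vzero X
  | VAdd a b => vadd X (veval X env a) (veval X env b)
  | VOpp a => vopp X (veval X env a)
  | VScal r a => vscal X r (veval X env a)
  end.

Fixpoint vcoef (e : vexpr) (i : nat) : R :=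
  match e with
  | VVar n => if Nat.eqb n i then 1 else 0
  | VZero => 0
  | VAdd a b => vcoef a i + vcoef b i
  | VOpp a => - vcoef a i
  | VScal r a => r * vcoef a i
  end.

Fixpoint lincomb (X : Banach) (env : list X) (c : nat -> R) : X :=
  match env with
  | nil => vzero X
  | x :: l => vadd X (vscal X (c 0%nat) x) (lincomb X l (fun i => c (S i)))
  end.

(** Unfolds to one real equation per atom, which suits coefficients that are arbitrary real
    terms. *)
Fixpoint agree {T} (l : list T) (c d : nat -> R) : Prop :=
  match l with
  | nil => True
  | _ :: l => c 0%nat = d 0%nat /\ agree l (fun i => c (S i)) (fun i => d (S i))
  end.

Lemma vadd_0l (X : Banach) (x : X) : vadd X (vzero X) x = x.
Proof. rewrite vadd_comm; apply vadd_0. Qed.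

Lemma vadd_cancel (X : Banach) (x y z : X) : vadd X x y = vadd X x z -> y = z.
Proof.
  intro H. rewrite <- (vadd_0l X y), <- (vadd_0l X z), <- (vadd_opp X x).
  rewrite (vadd_comm X x), <- !vadd_assoc, H. reflexivity.
Qed.

Lemma vscal_0 (X : Banach) (x : X) : vscal X 0 x = vzero X.
Proof.
  apply vadd_cancel with (vscal X 0 x).
  rewrite <- vscal_distr_s, vadd_0. f_equal; ring.
Qed.

Lemma vopp_scal (X : Banach) (x : X) : vopp X x = vscal X (-1) x.
Proof.
  apply vadd_cancel with x. rewrite vadd_opp.
  rewrite <- (vscal_1 X x) at 1. rewrite <- vscal_distr_s.
  replace (1 + -1) with 0 by ring. now rewrite vscal_0.
Qed.

Lemma vscal_v0 (X : Banach) (a : R) : vscal X a (vzero X) = vzero X.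
Proof. rewrite <- (vscal_0 X (vzero X)), vscal_assoc, Rmult_0_r. reflexivity. Qed.

Lemma lincomb_ext (X : Banach) (env : list X) c d :
  agree env c d -> lincomb X env c = lincomb X env d.
Proof.
  revert c d; induction env as [|x l IH]; intros c d; simpl; [easy|].
  intros [E H]. now rewrite E, (IH _ _ H).
Qed.

Lemma agree_refl {T} (l : list T) c d : (forall i, c i = d i) -> agree l c d.
Proof. revert c d; induction l; simpl; auto. Qed.

Lemma lincomb_add (X : Banach) (env : list X) c d :
  lincomb X env (fun i => c i + d i) = vadd X (lincomb X env c) (lincomb X env d).
Proof.
  revert c d; induction env as [|x l IH]; intros c d; simpl.
  - now rewrite vadd_0.
  - rewrite (IH (fun i => c (S i)) (fun i => d (S i))), vscal_distr_s.
    rewrite <- !vadd_assoc; f_equal. rewrite !vadd_assoc; f_equal. apply vadd_comm.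
Qed.

Lemma lincomb_scal (X : Banach) (env : list X) r c :
  lincomb X env (fun i => r * c i) = vscal X r (lincomb X env c).
Proof.
  revert c; induction env as [|x l IH]; intros c; simpl.
  - now rewrite vscal_v0.
  - now rewrite (IH (fun i => c (S i))), vscal_distr_v, vscal_assoc.
Qed.

Lemma lincomb_zero (X : Banach) (env : list X) : lincomb X env (fun _ => 0) = vzero X.
Proof. induction env as [|x l IH]; simpl; [|rewrite IH, vscal_0, vadd_0]; reflexivity. Qed.

Lemma lincomb_var (X : Banach) (env : list X) n :
  lincomb X env (fun i => if Nat.eqb n i then 1 else 0) = nth n env (vzero X).
Proof.
  revert n; induction env as [|x l IH]; intros [|n]; simpl; auto.
  - now rewrite lincomb_zero, vscal_1, vadd_0.
  - now rewrite IH, vscal_0, vadd_0l.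
Qed.

Lemma veval_lincomb (X : Banach) (env : list X) e :
  veval X env e = lincomb X env (vcoef e).
Proof.
  induction e as [n| |a IHa b IHb|a IHa|r a IHa]; simpl.
  - symmetry; apply (lincomb_var X env n).
  - symmetry; apply lincomb_zero.
  - now rewrite IHa, IHb, <- lincomb_add.
  - rewrite IHa, vopp_scal, <- lincomb_scal. apply lincomb_ext, agree_refl; intro; ring.
  - now rewrite IHa, <- lincomb_scal.
Qed.

Lemma veval_eq (X : Banach) (env : list X) e1 e2 :
  agree env (vcoef e1) (vcoef e2) -> veval X env e1 = veval X env e2.
Proof. rewrite !veval_lincomb. apply lincomb_ext. Qed.

Ltac vec_index x l :=
  lazymatch l with
  | x :: _ => constr:(0%nat)
  | _ :: ?l' => let n := vec_index x l' in constr:(S n)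
  end.

Ltac vec_mem x l :=
  lazymatch l with
  | nil => constr:(false)
  | x :: _ => constr:(true)
  | _ :: ?l' => vec_mem x l'
  end.

Ltac vec_atoms e l :=
  lazymatch e with
  | vzero _ => l
  | vadd _ ?a ?b => let l' := vec_atoms a l in vec_atoms b l'
  | vopp _ ?a => vec_atoms a l
  | vscal _ _ ?a => vec_atoms a l
  | _ => lazymatch vec_mem e l with true => l | false => constr:(e :: l) end
  end.

Ltac vec_reify e l :=
  lazymatch e with
  | vzero _ => constr:(VZero)
  | vadd _ ?a ?b =>
      let a' := vec_reify a l in let b' := vec_reify b l in constr:(VAdd a' b')
  | vopp _ ?a => let a' := vec_reify a l in constr:(VOpp a')
  | vscal _ ?r ?a => let a' := vec_reify a l in constr:(VScal r a')
  | _ => let n := vec_index e l in constr:(VVar n)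
  end.

Ltac vec_start :=
  unfold vsub;
  lazymatch goal with
  | |- @eq (carrier ?X) ?a ?b =>
      let l := vec_atoms a (@nil (carrier X)) in
      let l := vec_atoms b l in
      let ea := vec_reify a l in
      let eb := vec_reify b l in
      change (veval X l ea = veval X l eb); apply veval_eq;
      cbn [agree vcoef Nat.eqb]; repeat split
  end.

Ltac vec := vec_start; try field; auto with real; try lra.

(** * Norms and functionals *)

Lemma vnorm_0 (X : Banach) : vnorm X (vzero X) = 0.
Proof. rewrite <- (vscal_0 X (vzero X)), vnorm_scal, Rabs_R0; ring. Qed.

Lemma vnorm_scal_pos (X : Banach) a (x : X) : 0 <= a -> vnorm X (vscal X a x) = a * vnorm X x.
Proof. intro H. now rewrite vnorm_scal, Rabs_right by lra. Qed.

Lemma vnorm_opp (X : Banach) (x : X) : vnorm X (vopp X x) = vnorm X x.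
Proof. rewrite vopp_scal, vnorm_scal, Rabs_left by lra; ring. Qed.

Lemma vnorm_ge0 (X : Banach) (x : X) : 0 <= vnorm X x.
Proof.
  generalize (vnorm_triangle X x (vopp X x)).
  rewrite vadd_opp, vnorm_0, vnorm_opp; lra.
Qed.

Lemma vnorm_subC (X : Banach) (x y : X) : vnorm X (vsub x y) = vnorm X (vsub y x).
Proof. replace (vsub y x) with (vopp X (vsub x y)) by vec. now rewrite vnorm_opp. Qed.

Lemma vnorm_sub_triangle (X : Banach) (y x z : X) :
  vnorm X (vsub x z) <= vnorm X (vsub x y) + vnorm X (vsub y z).
Proof. replace (vsub x z) with (vadd X (vsub x y) (vsub y z)) by vec. apply vnorm_triangle. Qed.

Lemma dfun_0 (X : Banach) (xs : dual X) : xs (vzero X) = 0.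
Proof. rewrite <- (vscal_0 X (vzero X)), dfun_scal; ring. Qed.

Lemma dfun_opp (X : Banach) (xs : dual X) x : xs (vopp X x) = - xs x.
Proof. rewrite vopp_scal, dfun_scal; ring. Qed.

Definition dual_comb (X : Banach) (a : R) (xs : dual X) (b : R) (ys : dual X) : dual X.
Proof.
  refine (@Build_dual X (fun u => a * xs u + b * ys u) _ _ _).
  - abstract (intros x y; rewrite !dfun_add; ring).
  - abstract (intros c x; rewrite !dfun_scal; ring).
  - abstract (destruct (dfun_bounded xs) as [M HM]; destruct (dfun_bounded ys) as [N HN];
      exists (Rabs a * M + Rabs b * N); intro x;
      eapply Rle_trans; [apply Rabs_triang|]; rewrite !Rabs_mult;
      generalize (Rmult_le_compat_l _ _ _ (Rabs_pos a) (HM x))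
                 (Rmult_le_compat_l _ _ _ (Rabs_pos b) (HN x)); lra).
Defined.

#[local] Hint Rewrite @dfun_add @dfun_opp @dfun_scal @dfun_0 : dual_linear.

Ltac dual_simpl := unfold pairing, vsub in *; autorewrite with dual_linear in *.

(** * The Hahn-Banach theorem *)

Definition sublinear (X : Banach) (p : X -> R) : Prop :=
  (forall x y, p (vadd X x y) <= p x + p y) /\
  (forall a x, 0 <= a -> p (vscal X a x) = a * p x).

Lemma inf_exists (S : R -> Prop) :
  (exists s, S s) -> (exists m, forall s, S s -> m <= s) ->
  exists i, (forall s, S s -> i <= s) /\ (forall m, (forall s, S s -> m <= s) -> m <= i).
Proof.
  intros [s0 H0] [m Hm].
  destruct (completeness (fun r => S (- r))) as [i [Hi1 Hi2]].
  - exists (- m). intros r Hr. specialize (Hm _ Hr); lra.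
  - exists (- s0). now rewrite Ropp_involutive.
  - exists (- i); split.
    + intros s Hs. assert (- s <= i) by (apply Hi1; now rewrite Ropp_involutive). lra.
    + intros k Hk. assert (i <= - k) by (apply Hi2; intros r Hr; specialize (Hk _ Hr); lra). lra.
Qed.

(** The pairs form a convex cone up to lowering the second entry. The envelope is finite at [x]
    because a value at [- x] bounds those at [x] from below through the values at [0]. It serves for
    the perturbation [q_y], for infima of chains and for conical hulls. *)
Lemma sublinear_inf (X : Banach) (C : X -> R -> Prop) :
  (forall x, exists s, C x s) ->
  (forall x y s t, C x s -> C y t -> exists u, C (vadd X x y) u /\ u <= s + t) ->
  (forall a x s, 0 < a -> C x s -> exists u, C (vscal X a x) u /\ u <= a * s) ->
  (forall s, C (vzero X) s -> 0 <= s) ->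
  exists q, sublinear X q /\ (forall x s, C x s -> q x <= s) /\
    (forall x m, (forall s, C x s -> m <= s) -> m <= q x).
Proof.
  intros Hne Hadd Hscal H0.
  assert (Hinf : forall x, exists i, (forall s, C x s -> i <= s) /\
                   (forall m, (forall s, C x s -> m <= s) -> m <= i)).
  { intro x. apply inf_exists; [apply Hne|].
    destruct (Hne (vopp X x)) as [t Ht]. exists (- t). intros s Hs.
    destruct (Hadd _ _ _ _ Hs Ht) as [u [Hu Hle]].
    rewrite vadd_opp in Hu. specialize (H0 _ Hu). lra. }
  destruct (boolp.choice Hinf) as [q Hq].
  assert (Hq1 : forall x s, C x s -> q x <= s) by (intro x; apply Hq).
  assert (Hq2 : forall x m, (forall s, C x s -> m <= s) -> m <= q x) by (intro x; apply Hq).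
  exists q. split; [|split; assumption].
  (* One inequality suffices: applied to [/ a] it gives the reverse one. *)
  assert (Hs : forall a x, 0 < a -> q (vscal X a x) <= a * q x).
  { intros a x Ha.
    assert (q (vscal X a x) / a <= q x).
    { apply Hq2. intros s Hs. destruct (Hscal _ _ _ Ha Hs) as [u [Hu Hle]].
      apply Hq1 in Hu. apply Rmult_le_reg_l with a; [assumption|].
      replace (a * (q (vscal X a x) / a)) with (q (vscal X a x)) by (field; lra). lra. }
    apply Rmult_le_compat_l with (r := a) in H; [|lra].
    replace (a * (q (vscal X a x) / a)) with (q (vscal X a x)) in H by (field; lra). exact H. }
  split.
  - intros x y.
    assert (q (vadd X x y) - q y <= q x); [|lra].
    apply Hq2; intros s Hx.
    assert (q (vadd X x y) - s <= q y); [|lra].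
    apply Hq2; intros t Hy.
    destruct (Hadd _ _ _ _ Hx Hy) as [u [Hu Hle]]. apply Hq1 in Hu. lra.
  - intros a x [Ha|<-].
    + apply Rle_antisym; [now apply Hs|].
      generalize (Hs (/ a) (vscal X a x) (Rinv_0_lt_compat _ Ha)).
      rewrite vscal_assoc, Rinv_l, vscal_1 by lra. intro H.
      apply Rmult_le_compat_l with (r := a) in H; [|lra].
      rewrite <- Rmult_assoc, Rinv_r in H by lra. lra.
    + rewrite vscal_0, Rmult_0_l. apply Rle_antisym.
      (* From [q 0 <= q 0 / 2] follows [q 0 <= 0]. *)
      * generalize (Hs (/ 2) (vzero X) ltac:(lra)). rewrite vscal_v0. lra.
      * apply Hq2, H0.
Qed.

(* [q_y x = inf_{l >= 0} (q (x + l y) - l q y)] is a sublinear minorant of [q]; when [q]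
   is minimal, [q_y = q], and the value [l = 1] gives superadditivity. *)
Lemma minimal_sublinear_additive (X : Banach) (q : X -> R) :
  sublinear X q ->
  (forall r, sublinear X r -> (forall x, r x <= q x) -> r = q) ->
  forall x y, q (vadd X x y) = q x + q y.
Proof.
  intros [Hadd Hsc] Hmin x y. apply Rle_antisym; [apply Hadd|].
  destruct (sublinear_inf X (fun u s => exists l, 0 <= l /\
      s = q (vadd X u (vscal X l y)) - l * q y)) as [r [Hr [Hr1 _]]].
  - intro u. eexists; exists 0; split; [lra|reflexivity].
  - intros u v s t [l [Hl ->]] [m [Hm ->]].
    eexists; split; [exists (l + m); split; [lra|reflexivity]|].
    replace (vadd X (vadd X u v) (vscal X (l + m) y)) with
      (vadd X (vadd X u (vscal X l y)) (vadd X v (vscal X m y))) by vec.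
    generalize (Hadd (vadd X u (vscal X l y)) (vadd X v (vscal X m y))). lra.
  - intros a u s Ha [l [Hl ->]].
    eexists; split; [exists (a * l); split; [nra|reflexivity]|].
    replace (vadd X (vscal X a u) (vscal X (a * l) y)) with
      (vscal X a (vadd X u (vscal X l y))) by vec.
    rewrite Hsc by lra. lra.
  - intros s [l [Hl ->]]. rewrite vadd_0l, Hsc by assumption. lra.
  - assert (E : r = q).
    { apply Hmin; [assumption|]. intro u. apply Hr1. exists 0; split; [lra|].
      rewrite vscal_0, vadd_0; ring. }
    subst r. specialize (Hr1 x (q (vadd X x y) - q y)).
    assert (q x <= q (vadd X x y) - q y); [|lra].
    apply Hr1. exists 1; split; [lra|]. rewrite vscal_1; ring.
Qed.

(** Zorn's lemma for the reversed pointwise order on the sublinear functions below [p]. The infimum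
    of a chain is subadditive because, of any two members, one lies below the other. *)
Lemma minimal_sublinear_exists (X : Banach) (p : X -> R) :
  sublinear X p ->
  exists q, sublinear X q /\ (forall x, q x <= p x) /\
    (forall r, sublinear X r -> (forall x, r x <= q x) -> r = q).
Proof.
  intro Hp.
  pose (T := {q : X -> R | sublinear X q /\ forall x, q x <= p x}).
  pose (ge := fun a b : T => boolp.asbool (forall x, proj1_sig b x <= proj1_sig a x)).
  assert (geP : forall a b, is_true (ge a b) <-> forall x, proj1_sig b x <= proj1_sig a x)
    by (intros a b; split; intro H; [exact (boolp.asboolW H) | exact (boolp.asboolT H)]).
  destruct (@classical_sets.Zorn T ge) as [[q [Hq Hqp]] Hmin].
  - intro a. apply (proj2 (geP _ _)); intro; lra.
  - intros a b c H1 H2. apply (proj2 (geP _ _)); intro x.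
    generalize (proj1 (geP _ _) H1 x) (proj1 (geP _ _) H2 x); lra.
  - intros [a Ha] [b Hb] H1 H2.
    generalize (proj1 (geP _ _) H1) (proj1 (geP _ _) H2); simpl; clear H1 H2; intros H1 H2.
    assert (a = b) by (apply functional_extensionality; intro x; now apply Rle_antisym).
    subst b. f_equal; apply proof_irrelevance.
  - intros A HA.
    destruct (classic (exists a, A a)) as [[a0 Ha0]|Hempty].
    (* The empty chain is bounded by [p] itself. *)
    2:{ exists (exist _ p (conj Hp (fun x => Rle_refl (p x)))). intros s Hs.
        contradict Hempty; now exists s. }
    destruct (sublinear_inf X (fun x s => exists a, A a /\ s = proj1_sig a x))
      as [r [Hr [Hr1 _]]].
    + intro x. eexists; exists a0; eauto.
    + intros x y s t [a [Ha ->]] [b [Hb ->]].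
      destruct (HA a b Ha Hb) as [H|H]; generalize (proj1 (geP _ _) H); clear H; intro H.
      * eexists; split; [exists b; split; [assumption|reflexivity]|].
        generalize (proj1 (proj1 (proj2_sig b)) x y) (H x); lra.
      * eexists; split; [exists a; split; [assumption|reflexivity]|].
        generalize (proj1 (proj1 (proj2_sig a)) x y) (H y); lra.
    + intros c x s Hc [a [Ha ->]]. eexists; split; [exists a; split; [assumption|reflexivity]|].
      rewrite (proj2 (proj1 (proj2_sig a))); lra.
    + intros s [a [Ha ->]].
      rewrite <- (vscal_0 X (vzero X)), (proj2 (proj1 (proj2_sig a))); lra.
    + assert (Hrp : forall x, r x <= p x).
      { intro x. apply Rle_trans with (proj1_sig a0 x); [apply Hr1; eauto|].
        apply (proj2 (proj2_sig a0)). }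
      exists (exist _ r (conj Hr Hrp)). intros s Hs. apply (proj2 (geP _ _)); intro x; simpl. apply Hr1; eauto.
  - exists q; split; [assumption|split; [assumption|]]. intros r Hr Hrq.
    assert (Hrp : forall x, r x <= p x) by (intro x; generalize (Hrq x) (Hqp x); lra).
    exact (f_equal (@proj1_sig _ _)
      (Hmin (exist _ r (conj Hr Hrp)) (proj2 (geP (exist _ q _) (exist _ r _)) Hrq))).
Qed.

(** Rescaling [x] to norm [r / 2], inside the open ball, produces the factor [2]. *)
Lemma homogeneous_norm_bound (X : Banach) (q : X -> R) (r M : R) :
  0 < r -> (forall a x, 0 <= a -> q (vscal X a x) = a * q x) ->
  (forall x, vnorm X x < r -> q x <= M) ->
  forall x, q x <= 2 * M / r * vnorm X x.
Proof.
  intros Hr Hq HM x.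
  destruct (Rle_lt_or_eq_dec _ _ (vnorm_ge0 X x)) as [Hx|Hx].
  - assert (Ha : 0 < r / (2 * vnorm X x)) by (apply Rdiv_lt_0_compat; lra).
    assert (H : q (vscal X (r / (2 * vnorm X x)) x) <= M).
    { apply HM. rewrite vnorm_scal_pos by lra.
      replace (r / (2 * vnorm X x) * vnorm X x) with (r / 2) by (field; lra). lra. }
    rewrite Hq in H by lra.
    apply Rmult_le_reg_l with (1 := Ha).
    replace (r / (2 * vnorm X x) * (2 * M / r * vnorm X x)) with M by (field; lra). exact H.
  - symmetry in Hx. apply vnorm_eq0 in Hx. subst x.
    rewrite vnorm_0, Rmult_0_r, <- (vscal_0 X (vzero X)), Hq by lra. lra.
Qed.

(* The conical hull of [E] is the epigraph of a finite sublinear function, and [y] is a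
   linear minorant of it. *)
Lemma linear_minorant (X : Banach) (E : X -> R -> Prop) (r M : R) :
  0 < r ->
  (forall x, vnorm X x < r -> E x M) ->
  (forall x y s t l, 0 < l < 1 -> E x s -> E y t ->
     E (vadd X (vscal X l x) (vscal X (1 - l) y)) (l * s + (1 - l) * t)) ->
  (forall s, E (vzero X) s -> 0 <= s) ->
  exists y : dual X, forall x s, E x s -> y x <= s.
Proof.
  intros Hr HM Hcvx H0.
  (* The cone generated by [E]. *)
  pose (C := fun x s => exists l, 0 < l /\ E (vscal X l x) (l * s)).
  assert (HC : forall x, C x (M * (2 * (vnorm X x + 1) / r))).
  { intro x. generalize (vnorm_ge0 X x); intro Hx.
    (* This factor brings [x] into the ball; the [+ 1] covers [x = 0]. *)
    exists (r / (2 * (vnorm X x + 1))). split.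
    - apply Rdiv_lt_0_compat; lra.
    - replace (r / (2 * (vnorm X x + 1)) * (M * (2 * (vnorm X x + 1) / r)))
        with M by (field; lra). apply HM.
      rewrite vnorm_scal_pos by (left; apply Rdiv_lt_0_compat; lra).
      apply Rmult_lt_reg_r with (2 * (vnorm X x + 1)); [lra|].
      replace (_ * _) with (r * vnorm X x) by (field; lra). nra. }
  destruct (sublinear_inf X C) as [p [Hp [Hp1 _]]].
  - intro x. eexists; apply HC.
  - intros x y s t [l [Hl H1]] [m [Hm H2]]. exists (s + t); split; [|lra].
    (* The weights [m / (l + m)] and [l / (l + m)] combine [l x] and [m y] into a multiple of
       [x + y]. *)
    exists (l * m / (l + m)). split; [apply Rdiv_lt_0_compat; nra|].
    replace (vscal X (l * m / (l + m)) (vadd X x y)) with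
      (vadd X (vscal X (m / (l + m)) (vscal X l x))
              (vscal X (1 - m / (l + m)) (vscal X m y))) by (vec_start; field; lra).
    replace (l * m / (l + m) * (s + t)) with
      (m / (l + m) * (l * s) + (1 - m / (l + m)) * (m * t)) by (field; lra).
    apply Hcvx; [|assumption|assumption].
    split; [apply Rdiv_lt_0_compat; lra|].
    apply Rmult_lt_reg_r with (l + m); [lra|]. unfold Rdiv.
    rewrite Rmult_assoc, Rinv_l by lra. lra.
  - intros a x s Ha [l [Hl H1]]. exists (a * s); split; [|lra].
    exists (l / a); split; [apply Rdiv_lt_0_compat; lra|].
    replace (vscal X (l / a) (vscal X a x)) with (vscal X l x) by (vec_start; field; lra).
    replace (l / a * (a * s)) with (l * s) by (field; lra). exact H1.
  - intros s [l [Hl H1]]. rewrite vscal_v0 in H1. specialize (H0 _ H1). nra.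
  - destruct (minimal_sublinear_exists X p Hp) as [q [Hq [Hqp Hmin]]].
    generalize (minimal_sublinear_additive X q Hq Hmin); intro Hadd.
    assert (HqC : forall x s, C x s -> q x <= s)
      by (intros x s H; apply Rle_trans with (p x); [apply Hqp|now apply Hp1]).
    assert (Hopp : forall x, q (vopp X x) = - q x).
    { intro x. generalize (Hadd x (vopp X x)). rewrite vadd_opp.
      rewrite <- (vscal_0 X x), (proj2 Hq) by lra. lra. }
    assert (Hscal : forall a x, q (vscal X a x) = a * q x).
    { intros a x. destruct (Rle_lt_dec 0 a) as [Ha|Ha]; [now apply (proj2 Hq)|].
      replace (vscal X a x) with (vopp X (vscal X (- a) x)) by vec.
      rewrite Hopp, (proj2 Hq) by lra. ring. }
    assert (Hb : forall x, q x <= 2 * M / r * vnorm X x).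
    { apply homogeneous_norm_bound; [assumption|intros; apply Hscal|].
      intros x Hx. apply HqC. exists 1; split; [lra|].
      rewrite vscal_1, Rmult_1_l. now apply HM. }
    assert (Hbound : exists N, forall x, Rabs (q x) <= N * vnorm X x).
    { exists (2 * M / r). intro x. apply Rabs_le; split; [|apply Hb].
      generalize (Hb (vopp X x)). rewrite Hopp, vnorm_opp. lra. }
    exists (@Build_dual X q Hadd Hscal Hbound). intros x s H. apply HqC.
    exists 1; split; [lra|]. now rewrite vscal_1, Rmult_1_l.
Qed.

(** * Convex functions *)

(** The epigraph, at real heights only: arithmetic stays in [R], and [exists c, epi f x c] expresses
    that [x] lies in the domain of [f]. *)
Definition epi {X : Banach} (f : X -> ereal) (x : X) (c : R) : Prop := ele (f x) (Fin c).

(** Stands in for the interior of the domain: an upper bound on a ball is what [linear_minorant]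
    asks for, and it propagates along segments. *)
Definition bounded_near {X : Banach} (f : X -> ereal) (x : X) : Prop :=
  exists r C, 0 < r /\ forall u, vnorm X (vsub u x) < r -> epi f u C.

Lemma small_scale (K e : R) : 0 <= K -> 0 < e -> exists t, 0 < t < 1 /\ t * K < e.
Proof.
  intros HK He. exists (e / (K + e + 1)).
  assert (Ht : 0 < e / (K + e + 1)) by (apply Rdiv_lt_0_compat; lra).
  assert (E : e / (K + e + 1) * (K + e + 1) = e) by (field; lra).
  repeat split; nra.
Qed.

Lemma nonpos_of_le_scale (d K : R) : (forall t, 0 < t < 1 -> d <= t * K) -> d <= 0.
Proof.
  intro H. apply Rnot_lt_le; intro Hd.
  destruct (small_scale (Rabs K) d (Rabs_pos _) Hd) as [t [Ht HtK]].
  specialize (H t Ht). generalize (Rle_abs K). nra.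
Qed.

Lemma Rabs_le_inv (a b : R) : Rabs a <= b -> - b <= a <= b.
Proof. generalize (Rle_abs a) (Rle_abs (- a)). rewrite Rabs_Ropp. lra. Qed.

Lemma epi_le (X : Banach) (f : X -> ereal) x a b : epi f x a -> a <= b -> epi f x b.
Proof. unfold epi; destruct (f x); simpl; intros; lra. Qed.

Lemma epi_fin (X : Banach) (f : X -> ereal) x c :
  epi f x c -> exists p, f x = Fin p /\ p <= c.
Proof. unfold epi; destruct (f x) as [p|]; simpl; [intro; now exists p|easy]. Qed.

Lemma epi_self (X : Banach) (f : X -> ereal) x p : f x = Fin p -> epi f x p.
Proof. unfold epi; intros ->; simpl; lra. Qed.

Lemma epi_convex (X : Banach) (f : X -> ereal) x y a b t :
  convex f -> 0 <= t <= 1 -> epi f x a -> epi f y b ->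
  epi f (vadd X (vscal X t x) (vscal X (1 - t) y)) (t * a + (1 - t) * b).
Proof.
  intros Hf Ht Hx Hy.
  destruct (Req_dec t 0) as [->|H0].
  { replace (vadd X _ _) with y by vec. apply epi_le with b; [assumption|lra]. }
  destruct (Req_dec t 1) as [->|H1].
  { replace (vadd X _ _) with x by vec. apply epi_le with a; [assumption|lra]. }
  destruct (epi_fin X f x a Hx) as [p [Ep Hp]], (epi_fin X f y b Hy) as [q [Eq Hq]].
  generalize (Hf x y t ltac:(lra)). rewrite Ep, Eq. intro H.
  apply epi_le with (1 := H). nra.
Qed.

(** Closedness of the epigraph; one [d] controls both the distance and the excess in height. *)
Lemma epi_lsc (X : Banach) (f : X -> ereal) w c :
  lsc f -> (forall d, 0 < d -> exists u, vnorm X (vsub u w) < d /\ epi f u (c + d)) ->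
  epi f w c.
Proof.
  intros Hf H. apply NNPP; intro Hn.
  assert (Hr : exists r, c < r /\ elt (Fin r) (f w)).
  { unfold epi in Hn; destruct (f w) as [s|]; simpl in *.
    - exists ((c + s) / 2); lra.
    - exists (c + 1); split; [lra|trivial]. }
  destruct Hr as [r [Hcr Hr]]. destruct (Hf w r Hr) as [d [Hd Hlow]].
  destruct (H (Rmin d (r - c))) as [u [Hu Hc]]; [apply Rmin_pos; lra|].
  generalize (Rmin_l d (r - c)) (Rmin_r d (r - c)); intros.
  specialize (Hlow u ltac:(lra)). unfold epi in Hc. destruct (f u); simpl in *; lra.
Qed.

(** A subgradient at a point of value [PInf] would force [f] to be [PInf] everywhere, against
    properness; so the inequality is one between reals. *)
Lemma subdiff_epi (X : Banach) (f : X -> ereal) x xs :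
  proper f ->
  (subdiff f x xs <->
   exists p, f x = Fin p /\ forall y c, epi f y c -> p + (xs y - xs x) <= c).
Proof.
  intros [u Hu]. unfold subdiff, epi. split.
  - intro H. destruct (f x) as [p|] eqn:E.
    + exists p; split; [reflexivity|]. intros y c Hy. specialize (H y).
      destruct (f y); simpl in *; [|easy]. dual_simpl. lra.
    + specialize (H u). destruct (f u); simpl in *; [easy|now contradict Hu].
  - intros [p [E H]] y. rewrite E. specialize (H y).
    destruct (f y) as [q|]; simpl; [|trivial].
    specialize (H q (Rle_refl q)). dual_simpl. lra.
Qed.

Lemma bounded_near_epi (X : Banach) (f : X -> ereal) x :
  bounded_near f x -> exists c, epi f x c.
Proof.
  intros [r [C [Hr HC]]]. exists C. apply HC.
  replace (vsub x x) with (vzero X) by vec. now rewrite vnorm_0.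
Qed.

Lemma bounded_near_open (X : Banach) (f : X -> ereal) x :
  bounded_near f x -> exists d, 0 < d /\ forall u, vnorm X (vsub u x) < d -> bounded_near f u.
Proof.
  intros [r [C [Hr HC]]]. exists (r / 2); split; [lra|]. intros u Hu.
  exists (r / 2), C; split; [lra|]. intros y Hy. apply HC.
  generalize (vnorm_sub_triangle X u y x). lra.
Qed.

(** The homothety with centre [u] and ratio [t] carries the ball around [x] to a ball of radius
    [t * r], where convexity bounds [f]. *)
Lemma bounded_near_segment (X : Banach) (f : X -> ereal) x u c t :
  convex f -> bounded_near f x -> epi f u c -> 0 < t <= 1 ->
  bounded_near f (vadd X (vscal X t x) (vscal X (1 - t) u)).
Proof.
  intros Hf [r [C [Hr HC]]] Hu Ht.
  exists (t * r), (t * C + (1 - t) * c). split; [nra|]. intros y Hy.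
  set (m := vadd X _ _) in Hy.
  replace y with (vadd X (vscal X t (vadd X x (vscal X (/ t) (vsub y m))))
                         (vscal X (1 - t) u)) by (unfold m; vec_start; field; lra).
  apply epi_convex; [assumption|lra| |assumption].
  apply HC. replace (vsub _ x) with (vscal X (/ t) (vsub y m)) by vec.
  rewrite vnorm_scal_pos by (left; apply Rinv_0_lt_compat; lra).
  apply Rmult_lt_reg_l with t; [lra|].
  rewrite <- Rmult_assoc, Rinv_r by lra. lra.
Qed.

(* Baire category: were [f] unbounded above on all small balls, lower semicontinuity would
   give nested balls on which [f > n], and [f] would be infinite at their common point. *)
Lemma bounded_near_interior (X : Banach) (f : X -> ereal) x :
  lsc f -> convex f -> norm_interior (fun u => exists c, epi f u c) x -> bounded_near f x.
Proof.
  intros Hlsc Hcvx [d [Hd Hdom]].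
  destruct (classic (exists y r C, 0 < r /\ vnorm X (vsub y x) < d /\
     forall u, vnorm X (vsub u y) < r -> epi f u C)) as [[y [r [C [Hr [Hy HC]]]]]|Hno].
  (* The reflected point [2 x - y] is in the domain, and [x] is its midpoint with [y], near which
     [f] is bounded. *)
  - destruct (Hdom (vadd X x (vsub x y))) as [c Hc].
    { replace (vsub (vadd X x (vsub x y)) x) with (vsub x y) by vec. now rewrite vnorm_subC. }
    replace x with (vadd X (vscal X (1/2) y) (vscal X (1 - 1/2) (vadd X x (vsub x y)))) by vec.
    apply bounded_near_segment with c; [assumption| |assumption|lra].
    exists r, C; auto.
  - exfalso.
    pose (good := fun B : X * R => 0 < snd B /\ vnorm X (vsub (fst B) x) + snd B < d).
    assert (Hstep : forall nB : nat * (X * R), exists B' : X * R, good (snd nB) ->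
       good B' /\ vnorm X (vsub (fst B') (fst (snd nB))) + snd B' <= snd (snd nB) /\
       snd B' <= snd (snd nB) / 2 /\
       forall u, vnorm X (vsub u (fst B')) <= snd B' -> elt (Fin (INR (fst nB))) (f u)).
    { intros [n [y r]]; simpl. destruct (classic (good (y, r))) as [[Hr Hy]|Hg];
        [|exists (y, r); intro; contradiction]. simpl in *.
      assert (Hu : exists u, vnorm X (vsub u y) < r /\ elt (Fin (INR n)) (f u)).
      { apply NNPP; intro Hc. apply Hno. exists y, r, (INR n).
        split; [assumption|split; [lra|]]. intros u Hu. unfold epi.
        apply NNPP; intro Hn. apply Hc. exists u; split; [assumption|].
        destruct (f u); simpl in *; [lra|trivial]. }
      destruct Hu as [u [Hu Hnu]]. destruct (Hlsc u _ Hnu) as [e [He Hlow]].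
      (* The closed ball of radius [s] stays where [f > n] and inside the previous ball, and the
         radius is at least halved. *)
      set (s := Rmin (e / 2) (Rmin (r - vnorm X (vsub u y)) (r / 2))).
      assert (Hs : 0 < s /\ s <= e / 2 /\ s <= r - vnorm X (vsub u y) /\ s <= r / 2).
      { unfold s. generalize (Rmin_l (e / 2) (Rmin (r - vnorm X (vsub u y)) (r / 2)))
          (Rmin_r (e / 2) (Rmin (r - vnorm X (vsub u y)) (r / 2)))
          (Rmin_l (r - vnorm X (vsub u y)) (r / 2)) (Rmin_r (r - vnorm X (vsub u y)) (r / 2)).
        repeat split; try lra. repeat apply Rmin_pos; lra. }
      exists (u, s); intros _; simpl. unfold good; simpl.
      generalize (vnorm_sub_triangle X y u x); intro.
      repeat split; try lra.
      intros v Hv. apply Hlow. lra. }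
    destruct (boolp.choice Hstep) as [next Hnext].
    pose (B := fix B n := match n with
                 | O => (x, d / 2) | S m => next (m, B m) end).
    assert (Hgood : forall n, good (B n)).
    { induction n as [|n IH].
      - unfold good; simpl. replace (vsub x x) with (vzero X) by vec. rewrite vnorm_0. lra.
      - exact (proj1 (Hnext (n, B n) IH)). }
    assert (Hin : forall n, vnorm X (vsub (fst (B (S n))) (fst (B n))) + snd (B (S n)) <= snd (B n) /\
       snd (B (S n)) <= snd (B n) / 2 /\
       forall u, vnorm X (vsub u (fst (B (S n)))) <= snd (B (S n)) -> elt (Fin (INR n)) (f u))
      by (intro n; exact (proj2 (Hnext (n, B n) (Hgood n)))).
    assert (Hnest : forall n k, vnorm X (vsub (fst (B (k + n)%nat)) (fst (B n))) +
                                snd (B (k + n)%nat) <= snd (B n)).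
    { intro n. induction k as [|k IH].
      - simpl. replace (vsub _ _) with (vzero X) by vec. rewrite vnorm_0. lra.
      - destruct (Hin (k + n)%nat) as [H1 _]. change (S k + n)%nat with (S (k + n)).
        generalize (vnorm_sub_triangle X (fst (B (k + n)%nat)) (fst (B (S (k + n)))) (fst (B n))).
        lra. }
    assert (Hle : forall n m, (n <= m)%nat -> vnorm X (vsub (fst (B m)) (fst (B n))) <= snd (B n)).
    { intros n m Hnm. generalize (Hnest n (m - n)%nat) (proj1 (Hgood m)).
      replace (m - n + n)%nat with m by lia. lra. }
    assert (Hrad : forall n, snd (B n) * 2 ^ n <= d).
    { induction n as [|n IH]; simpl; [lra|].
      destruct (Hin n) as [_ [H _]]. generalize (pow_lt 2 n). simpl in H. nra. }
    assert (Hsmall : forall e, 0 < e -> exists n, snd (B n) < e).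
    { intros e He. destruct (Pow_x_infinity 2 ltac:(rewrite Rabs_right; lra) (d / e + 1)) as [n Hn].
      exists n. specialize (Hn n (le_n n)). specialize (Hrad n).
      generalize (pow_lt 2 n ltac:(lra)); intro Hp. rewrite Rabs_right in Hn by lra.
      assert (e * (d / e) = d) by (field; lra). nra. }
    destruct (vcomplete X (fun n => fst (B n))) as [l Hl].
    { intros e He. destruct (Hsmall (e / 2) ltac:(lra)) as [N HN]. exists N. intros m n Hm Hn.
      change (vnorm X (vsub (fst (B m)) (fst (B n))) < e).
      generalize (vnorm_sub_triangle X (fst (B N)) (fst (B m)) (fst (B n))) (Hle N m Hm) (Hle N n Hn).
      rewrite (vnorm_subC X (fst (B N)) (fst (B n))). lra. }
    assert (Hlim : forall n, vnorm X (vsub l (fst (B n))) <= snd (B n)).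
    { intro n. apply Rnot_lt_le; intro Hlt.
      destruct (Hl (vnorm X (vsub l (fst (B n))) - snd (B n)) ltac:(lra)) as [N HN].
      specialize (HN (Nat.max N n) ltac:(lia)).
      fold (vsub (fst (B (Nat.max N n))) l) in HN. rewrite vnorm_subC in HN.
      generalize (vnorm_sub_triangle X (fst (B (Nat.max N n))) l (fst (B n)))
        (Hle n (Nat.max N n) ltac:(lia)). lra. }
    destruct (Hdom l) as [c Hc].
    { generalize (Hlim 0%nat); simpl. lra. }
    (* The limit [l] lies in every ball, and [B (S n)] is the one on which [f > n]. *)
    destruct (INR_unbounded c) as [n Hn].
    generalize (proj2 (proj2 (Hin n)) l (Hlim (S n))).
    unfold epi in Hc. destruct (f l); simpl in *; [lra|easy].
Qed.

(** * Subgradients, normals and exit points *)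

(** A linear minorant of [f (x + u) - f x], as a function of [u], is a subgradient at [x]. *)
Lemma subdiff_of_bounded_near (X : Banach) (f : X -> ereal) x :
  proper f -> convex f -> bounded_near f x -> exists b, subdiff f x b.
Proof.
  intros Hp Hf Hb. destruct (bounded_near_epi X f x Hb) as [c0 Hc0].
  destruct (epi_fin X f x c0 Hc0) as [p [E _]].
  destruct Hb as [r [C [Hr HC]]].
  destruct (linear_minorant X (fun u s => epi f (vadd X x u) (p + s)) r (C - p)) as [b Hb].
  - assumption.
  - intros u Hu. replace (p + (C - p)) with C by ring. apply HC.
    now replace (vsub (vadd X x u) x) with u by vec.
  - intros u v s t l Hl Hu Hv.
    replace (vadd X x _) with (vadd X (vscal X l (vadd X x u)) (vscal X (1 - l) (vadd X x v))) by vec.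
    replace (p + _) with (l * (p + s) + (1 - l) * (p + t)) by ring.
    apply epi_convex; [assumption|lra|assumption|assumption].
  - intros s. rewrite vadd_0. unfold epi; rewrite E; simpl. lra.
  - exists b. apply subdiff_epi; [assumption|]. exists p; split; [assumption|].
    intros y c Hy. generalize (Hb (vsub y x) (c - p)).
    replace (vadd X x (vsub y x)) with y by vec. replace (p + (c - p)) with c by ring.
    intro H; specialize (H Hy). dual_simpl. lra.
Qed.

(* Infimal convolution of [f] with the cone [K |.|]. *)
Lemma subdiff_of_cone_minorant (X : Banach) (f : X -> ereal) w p K :
  proper f -> convex f -> f w = Fin p -> 0 <= K ->
  (forall u c, epi f u c -> p - K * vnorm X (vsub u w) <= c) ->
  exists b, subdiff f w b.
Proof.
  intros Hp Hf E HK Hmin.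
  destruct (linear_minorant X (fun x s => exists y u c, epi f y c /\ x = vsub y u /\
     c - p + K * vnorm X (vsub u w) <= s) 1 K) as [b Hb].
  - lra.
  (* With [y = w] the value is [K |x|], at most [K] on the unit ball. *)
  - intros x Hx. exists w, (vsub w x), p.
    split; [now apply epi_self|split; [vec|]].
    replace (vsub (vsub w x) w) with (vopp X x) by vec. rewrite vnorm_opp. nra.
  - intros x1 x2 s1 s2 l Hl [y1 [u1 [c1 [H1 [-> L1]]]]] [y2 [u2 [c2 [H2 [-> L2]]]]].
    exists (vadd X (vscal X l y1) (vscal X (1 - l) y2)),
      (vadd X (vscal X l u1) (vscal X (1 - l) u2)), (l * c1 + (1 - l) * c2).
    split; [apply epi_convex; auto; lra|split; [vec|]].
    replace (vsub (vadd X (vscal X l u1) (vscal X (1 - l) u2)) w) with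
      (vadd X (vscal X l (vsub u1 w)) (vscal X (1 - l) (vsub u2 w))) by vec.
    generalize (vnorm_triangle X (vscal X l (vsub u1 w)) (vscal X (1 - l) (vsub u2 w))).
    rewrite !vnorm_scal_pos by lra. intro Ht. apply (Rmult_le_compat_l K) in Ht; [|assumption]. nra.
  - intros s [y [u [c [Hy [Ex L]]]]].
    assert (Eu : u = y).
    { replace u with (vsub y (vsub y u)) by vec. rewrite <- Ex. vec. }
    subst u. generalize (Hmin y c Hy). lra.
  - exists b. apply subdiff_epi; [assumption|]. exists p; split; [assumption|].
    intros y c Hy.
    assert (H : b (vsub y w) <= c - p).
    { apply Hb. exists y, w, c. split; [assumption|split; [reflexivity|]].
      replace (vsub w w) with (vzero X) by vec. rewrite vnorm_0. lra. }
    dual_simpl. lra.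
Qed.

(* The functional is a linear minorant of the gauge of [dom f - x] that takes
   a value at least [1] at [w - x]. *)
Lemma normal_exists (X : Banach) (f : X -> ereal) x w :
  convex f -> bounded_near f x -> ~ bounded_near f w ->
  exists n : dual X, (forall u c, epi f u c -> n u - n w <= 0) /\ 0 < n w - n x.
Proof.
  intros Hf Hx Hw. destruct (bounded_near_epi X f x Hx) as [c0 Hc0].
  pose proof Hx as [r [C [Hr HC]]].
  generalize (vnorm_ge0 X (vsub w x)); intro Hwx.
  (* Makes [(y + w - x) / L] shorter than [r] whenever [|y| < 1]. *)
  set (L := 2 * (1 + vnorm X (vsub w x)) / r).
  assert (HL : 0 < L) by (apply Rdiv_lt_0_compat; lra).
  destruct (linear_minorant X (fun y s => exists l u c, 0 < l /\ epi f u c /\ s = l - 1 /\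
     y = vsub (vscal X l (vsub u x)) (vsub w x)) 1 (L - 1)) as [n Hn].
  - lra.
  - intros y Hy. exists L, (vadd X x (vscal X (/ L) (vadd X y (vsub w x)))), C.
    split; [assumption|split; [|split; [reflexivity|vec_start; field; lra]]].
    apply HC. replace (vsub _ x) with (vscal X (/ L) (vadd X y (vsub w x))) by vec.
    rewrite vnorm_scal_pos by (left; now apply Rinv_0_lt_compat).
    generalize (vnorm_triangle X y (vsub w x)); intro.
    apply Rmult_lt_reg_l with L; [assumption|].
    rewrite <- Rmult_assoc, Rinv_r by lra.
    replace (L * r) with (2 * (1 + vnorm X (vsub w x))) by (unfold L; field; lra). lra.
  - intros y1 y2 s1 s2 l Hl [l1 [u1 [c1 [Hl1 [H1 [-> ->]]]]]] [l2 [u2 [c2 [Hl2 [H2 [-> ->]]]]]].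
    (* The factors [l1] and [l2] combine to [m]; the points [u1] and [u2] then carry renormalized
       weights. *)
    set (m := l * l1 + (1 - l) * l2). assert (Hm : 0 < m) by (unfold m; nra).
    assert (Hq : 1 - l * l1 / m = (1 - l) * l2 / m) by (unfold m in *; field; lra).
    assert (0 < (1 - l) * l2 / m) by (apply Rdiv_lt_0_compat; nra).
    assert (0 < l * l1 / m) by (apply Rdiv_lt_0_compat; nra).
    exists m, (vadd X (vscal X (l * l1 / m) u1) (vscal X (1 - l * l1 / m) u2)),
      (l * l1 / m * c1 + (1 - l * l1 / m) * c2).
    split; [assumption|split; [apply epi_convex; auto; lra|split; [unfold m; ring|]]].
    vec_start; unfold m; field; unfold m in Hm; lra.
  - intros s [l [u [c [Hl [Hu [-> Ey]]]]]].
    (* If [l < 1], then [w = (1 - l) x + l u] gives positive weight to [x], so [f] would be bounded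
       near [w]. *)
    apply Rnot_lt_le; intro Hlt. apply Hw.
    replace w with (vadd X (vscal X (1 - l) x) (vscal X (1 - (1 - l)) u)).
    + apply bounded_near_segment with c; auto; lra.
    + replace w with (vadd X (vsub (vscal X l (vsub u x)) (vzero X)) x); [vec|].
      rewrite Ey. vec.
  - assert (Hln : forall l u c, 0 < l -> epi f u c -> l * (n u - n x) - (n w - n x) <= l - 1).
    { intros l u c Hl Hu.
      generalize (Hn _ _ (ex_intro _ l (ex_intro _ u (ex_intro _ c
        (conj Hl (conj Hu (conj eq_refl eq_refl))))))). dual_simpl. lra. }
    (* Take [u = x] and let [l] tend to [0]; below, [l = / t] tends to infinity and gives
       [n u - n x <= 1]. *)
    assert (H1 : 1 - (n w - n x) <= 0).
    { apply nonpos_of_le_scale with 1. intros t Ht.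
      generalize (Hln t x c0 ltac:(lra) Hc0). lra. }
    exists n; split; [|lra]. intros u c Hu.
    assert ((n u - n x) - 1 <= 0); [|lra].
    apply nonpos_of_le_scale with (n w - n x). intros t Ht.
    generalize (Hln (/ t) u c ltac:(apply Rinv_0_lt_compat; lra) Hu); intro H.
    apply (Rmult_le_compat_l t) in H; [|lra].
    replace (t * (/ t * (n u - n x) - (n w - n x))) with ((n u - n x) - t * (n w - n x)) in H
      by (field; lra).
    replace (t * (/ t - 1)) with (1 - t) in H by (field; lra). lra.
Qed.

(** [l] is the supremum of the parameters at which [f] is locally bounded. Convexity makes these an
    interval starting at [0], and openness keeps the supremum from being attained. *)
Lemma exit_point (X : Banach) (f : X -> ereal) x a :
  convex f -> bounded_near f x -> ~ bounded_near f a ->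
  exists l, 0 < l <= 1 /\
    (forall s, 0 <= s < l -> bounded_near f (vadd X (vscal X (1 - s) x) (vscal X s a))) /\
    ~ bounded_near f (vadd X (vscal X (1 - l) x) (vscal X l a)).
Proof.
  intros Hf Hx Ha.
  set (P := fun s => vadd X (vscal X (1 - s) x) (vscal X s a)).
  assert (P0 : P 0 = x) by (unfold P; vec). assert (P1 : P 1 = a) by (unfold P; vec).
  destruct (completeness (fun s => 0 <= s <= 1 /\ bounded_near f (P s))) as [l [Hub Hlub]].
  - exists 1. intros s [Hs _]; lra.
  - exists 0. rewrite P0. split; [lra|assumption].
  - assert (Hl0 : 0 <= l) by (apply Hub; rewrite P0; split; [lra|assumption]).
    assert (Hl1 : l <= 1) by (apply Hlub; intros s [Hs _]; lra).
    assert (Hbelow : forall s, 0 <= s < l -> bounded_near f (P s)).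
    { intros s Hs.
      assert (Hs' : exists s', s < s' /\ 0 <= s' <= 1 /\ bounded_near f (P s')).
      { apply NNPP; intro Hno. assert (l <= s); [|lra].
        apply Hlub. intros s' Hs'. apply Rnot_lt_le; intro. apply Hno; now exists s'. }
      destruct Hs' as [s' [Hlt [Hs' Hb]]]. destruct (bounded_near_epi X f _ Hb) as [c Hc].
      assert (E : s / s' * s' = s) by (field; lra).
      assert (0 <= s / s') by (apply Rle_mult_inv_pos; lra).
      replace (P s) with (vadd X (vscal X (1 - s / s') x) (vscal X (1 - (1 - s / s')) (P s')))
        by (unfold P; vec_start; field; lra).
      apply bounded_near_segment with c; auto. split; nra. }
    assert (Hnl : ~ bounded_near f (P l)).
    { intro Hb. destruct (Req_dec l 1) as [->|Hne]; [now rewrite P1 in Hb|].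
      destruct (bounded_near_open X f _ Hb) as [d [Hd Hopen]].
      destruct (small_scale (vnorm X (vsub a x)) d (vnorm_ge0 X _) Hd) as [t [Ht Htd]].
      assert (l + t * (1 - l) <= l); [|nra].
      apply Hub. split; [nra|]. apply Hopen.
      replace (vsub _ _) with (vscal X (t * (1 - l)) (vsub a x)) by (unfold P; vec).
      rewrite vnorm_scal_pos by nra. generalize (vnorm_ge0 X (vsub a x)). nra. }
    exists l. split; [|split; assumption]. split; [|assumption].
    destruct Hl0 as [|<-]; [assumption|]. now rewrite P0 in Hnl.
Qed.

(** * Sum of a linear relation and a subdifferential *)

Lemma linear_relation_comb (X : Banach) (A : operator X) a b x (xs : dual X) y (ys : dual X) :
  linear_relation A -> A x xs -> A y ys ->
  A (vadd X (vscal X a x) (vscal X b y)) (dual_comb X a xs b ys).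
Proof. intros [_ H] Hx Hy. now apply (H a b x xs y ys). Qed.

(** Adjoining [(z, zs)] to the graph keeps it monotone, so maximality applies. *)
Lemma maximally_monotone_mem (X : Banach) (A : operator X) z (zs : dual X) :
  maximally_monotone A ->
  (forall a a', A a a' -> 0 <= (a' a - a' z) - (zs a - zs z)) -> A z zs.
Proof.
  intros [Hmono Hmax] H.
  apply (Hmax (fun x xs => A x xs \/ (x = z /\ xs = zs))); [|auto|auto].
  intros x xs y ys [Hx|[-> ->]] [Hy|[-> ->]].
  - now apply Hmono.
  - generalize (H _ _ Hx). dual_simpl. lra.
  - generalize (H _ _ Hy). dual_simpl. lra.
  - dual_simpl. lra.
Qed.

(** * Monotone relatedness and estimates on drops *)

Definition related {X : Banach} (A : operator X) (f : X -> ereal) (z : X) (zs : dual X) : Prop :=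
  forall a a' b, A a a' -> subdiff f a b ->
    0 <= (a' a - a' z) + (b a - b z) - (zs a - zs z).

(** The homothety of centre [z] and ratio [t]. Ratios in []0, 1]] applied to a ball sweep out the
    drop; a ratio [1 + h] prolongs beyond it. *)
Definition drop {X : Banach} (z : X) (t : R) (v : X) : X :=
  vadd X (vscal X t v) (vscal X (1 - t) z).

(** Beyond convexity of the drop, the parameter [t] combines affinely, so an error term [M * t] does
    too; only the weight on [v] is renormalized. *)
Lemma drop_convex (X : Banach) (z : X) l t1 v1 t2 v2 :
  0 < l < 1 -> 0 < t1 <= 1 -> 0 < t2 <= 1 ->
  let t := l * t1 + (1 - l) * t2 in
  let k := l * t1 / t in
  0 < t <= 1 /\ 0 < k < 1 /\
  drop z t (vadd X (vscal X k v1) (vscal X (1 - k) v2)) =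
    vadd X (vscal X l (drop z t1 v1)) (vscal X (1 - l) (drop z t2 v2)).
Proof.
  intros Hl H1 H2 t k.
  assert (Ht : 0 < t) by (unfold t; nra).
  assert (Hk : 0 < k) by (unfold k; apply Rdiv_lt_0_compat; nra).
  assert (Hk' : 0 < 1 - k).
  { replace (1 - k) with ((1 - l) * t2 / t) by (unfold k, t in *; field; lra).
    apply Rdiv_lt_0_compat; nra. }
  split; [unfold t; nra|split; [lra|]].
  unfold drop. vec_start; unfold k, t in *; field; lra.
Qed.

Lemma vnorm_convex_lt (X : Banach) (x v1 v2 : X) k e :
  0 < k < 1 -> vnorm X (vsub v1 x) < e -> vnorm X (vsub v2 x) < e ->
  vnorm X (vsub (vadd X (vscal X k v1) (vscal X (1 - k) v2)) x) < e.
Proof.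
  intros Hk H1 H2.
  replace (vsub _ x) with (vadd X (vscal X k (vsub v1 x)) (vscal X (1 - k) (vsub v2 x))) by vec.
  generalize (vnorm_triangle X (vscal X k (vsub v1 x)) (vscal X (1 - k) (vsub v2 x))).
  rewrite !vnorm_scal_pos by lra. nra.
Qed.

(* Prolonging the segment [[z, v]] beyond [v] by the factor [h] stays in the ball where [f]
   is bounded. Testing a subgradient at [drop z t v] against these points bounds its slope
   in the direction away from [z]. *)
Lemma drop_estimate (X : Banach) (f : X -> ereal) x z :
  proper f -> convex f -> bounded_near f x ->
  exists e h C, 0 < e /\ 0 < h /\ 0 <= C /\
    (forall v y, vnorm X (vsub v x) < e -> vnorm X y < e ->
       exists c, epi f (vadd X (drop z (1 + h) v) y) c) /\
    (forall v t y b, vnorm X (vsub v x) < e -> 0 < t <= 1 -> vnorm X y < e ->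
       subdiff f (drop z t v) b ->
       (1 + h - t) / t * (b (drop z t v) - b z) + b y <= C).
Proof.
  intros Hp Hf Hx.
  destruct (subdiff_of_bounded_near X f x Hp Hf Hx) as [g Hg].
  apply subdiff_epi in Hg; [|assumption]. destruct Hg as [p [_ Hg]].
  destruct (dfun_bounded g) as [N HN].
  destruct Hx as [r [C [Hr HC]]].
  set (D := vnorm X (vsub z x)). assert (HD : 0 <= D) by apply vnorm_ge0.
  (* The moves [v - x], [h (v - z)] and [y] are each shorter than [r / 3], so their sum stays in the
     ball. *)
  destruct (small_scale (D + r / 3) (r / 3) ltac:(lra) ltac:(lra)) as [h [Hh HhD]].
  assert (Hball : forall v y, vnorm X (vsub v x) < r / 3 -> vnorm X y < r / 3 ->
            epi f (vadd X (drop z (1 + h) v) y) C).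
  { intros v y Hv Hy. apply HC. unfold drop.
    replace (vsub _ x) with
      (vadd X (vadd X (vsub v x) (vscal X h (vsub v z))) y) by vec.
    generalize (vnorm_triangle X (vadd X (vsub v x) (vscal X h (vsub v z))) y)
      (vnorm_triangle X (vsub v x) (vscal X h (vsub v z))) (vnorm_sub_triangle X x v z).
    rewrite vnorm_scal_pos, (vnorm_subC X x z) by lra. fold D. nra. }
  set (N' := Rabs N).
  (* The affine minorant given by the subgradient [g] bounds [f] below, uniformly on the bounded
     drop. *)
  assert (Hlow : forall v t c, vnorm X (vsub v x) < r / 3 -> 0 < t <= 1 ->
            epi f (drop z t v) c -> p - N' * (D + r / 3) <= c).
  { intros v t c Hv Ht Hc. specialize (Hg _ _ Hc).
    generalize (HN (vsub (drop z t v) x)). intro H.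
    assert (Hn : vnorm X (vsub (drop z t v) x) <= D + r / 3).
    { unfold drop.
      replace (vsub _ x) with (vadd X (vscal X t (vsub v x)) (vscal X (1 - t) (vsub z x))) by vec.
      generalize (vnorm_triangle X (vscal X t (vsub v x)) (vscal X (1 - t) (vsub z x))).
      rewrite !vnorm_scal_pos by lra. fold D. generalize (vnorm_ge0 X (vsub v x)). nra. }
    generalize (vnorm_ge0 X (vsub (drop z t v) x)) (Rabs_pos N) (Rle_abs N); intros.
    assert (N * vnorm X (vsub (drop z t v) x) <= N' * (D + r / 3)) by (unfold N'; nra).
    apply Rabs_le_inv in H.
    replace (g (vsub (drop z t v) x)) with (g (drop z t v) - g x) in H
      by (dual_simpl; ring). lra. }
  exists (r / 3), h, (Rabs (C - (p - N' * (D + r / 3)))).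
  repeat split; try lra; [apply Rabs_pos|intros; exists C; auto|].
  intros v t y b Hv Ht Hy Hb. apply subdiff_epi in Hb; [|assumption].
  destruct Hb as [q [Eq Hb]].
  generalize (Hlow v t q Hv Ht (epi_self X f _ q Eq)) (Hb _ _ (Hball v y Hv Hy))
    (Rle_abs (C - (p - N' * (D + r / 3)))).
  replace (b (vadd X (drop z (1 + h) v) y) - b (drop z t v)) with
    ((1 + h - t) / t * (b (drop z t v) - b z) + b y) by (unfold drop; dual_simpl; field; lra).
  lra.
Qed.

(* A segment of [dom A] leaving [int dom f] inside the drop would exit at a point [w] where
   [f] is subdifferentiable, since the subgradients along the segment stay bounded, and
   which admits a normal [n] to [dom f] with [n (w - z) < 0].  Adding large multiples of
   [n] to a subgradient at [w] contradicts relatedness. *)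
Lemma drop_bounded_near (X : Banach) (A : operator X) (f : X -> ereal) x z (zs : dual X) :
  linear_relation A -> proper f -> lsc f -> convex f -> related A f z zs ->
  dom_op A x -> bounded_near f x ->
  exists e h C, 0 < e /\ 0 < h /\ 0 <= C /\
    (forall v t b, vnorm X (vsub v x) < e -> 0 < t <= 1 -> subdiff f (drop z t v) b ->
       b (drop z t v) - b z <= C * t / h) /\
    (forall v t, vnorm X (vsub v x) < e -> 0 < t <= 1 -> dom_op A (drop z t v) ->
       bounded_near f (drop z t v)).
Proof.
  intros HA Hp Hlsc Hf Hrel [x' Hx'] Hx.
  destruct (drop_estimate X f x z Hp Hf Hx) as [e [h [C [He [Hh [HC [Hball Hest]]]]]]].
  exists e, h, C. do 3 (split; [assumption|]). split.
  { intros v t b Hv Ht Hb.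
    generalize (Hest v t (vzero X) b Hv Ht ltac:(now rewrite vnorm_0) Hb). rewrite dfun_0.
    set (s := b _ - b z). intro H.
    assert (H' : (1 + h - t) * s <= C * t).
    { apply (Rmult_le_compat_l t) in H; [|lra].
      replace (t * ((1 + h - t) / t * s + 0)) with ((1 + h - t) * s) in H by (field; lra). lra. }
    apply Rmult_le_reg_l with (1 := Hh).
    replace (h * (C * t / h)) with (C * t) by (field; lra).
    (* For [s > 0], use [1 + h - t >= h]; otherwise the left-hand side is nonpositive. *)
    destruct (Rle_lt_dec s 0); nra. }
  intros v t Hv Ht [a' Ha']. apply NNPP; intro Hna.
  set (a := drop z t v) in *.
  destruct (exit_point X f x a Hf Hx Hna) as [l [Hl [Hin Hout]]].
  set (P := fun s => vadd X (vscal X (1 - s) x) (vscal X s a)) in *.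
  (* The segment stays in the drop with parameters at least [t], which keeps the factor
     [(1 + h - ts) / ts] bounded. *)
  assert (HP : forall s, 0 <= s <= 1 -> exists ts vs, t <= ts <= 1 /\
            vnorm X (vsub vs x) < e /\ P s = drop z ts vs).
  { intros s Hs. destruct (Req_dec s 0) as [->|Hs0].
    { exists 1, x. replace (vsub x x) with (vzero X) by vec. rewrite vnorm_0.
      split; [lra|split; [lra|unfold P, drop; vec]]. }
    destruct (Req_dec s 1) as [->|Hs1].
    { exists t, v. split; [lra|split; [assumption|unfold P, a, drop; vec]]. }
    destruct (drop_convex X z (1 - s) 1 x t v ltac:(lra) ltac:(lra) Ht) as [Hts [Hk E]].
    eexists _, _. split; [|split; [|symmetry; etransitivity; [exact E|unfold P, a, drop; vec]]].
    - split; [|apply Hts]. nra.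
    - apply vnorm_convex_lt; [exact Hk| |exact Hv].
      replace (vsub x x) with (vzero X) by vec. now rewrite vnorm_0. }
  assert (HPA : forall s, A (P s) (dual_comb X (1 - s) x' s a'))
    by (intro s; now apply linear_relation_comb).
  (* Relatedness along the segment bounds the slopes below by a polynomial in [s] whose coefficients
     [C1] dominates. *)
  set (C1 := Rabs (x' x) + Rabs (x' a) + Rabs (a' x) + Rabs (a' a) + Rabs (x' z) +
             Rabs (a' z) + Rabs (zs x) + Rabs (zs a) + Rabs (zs z)).
  assert (HC1 : 0 <= C1) by (unfold C1; repeat apply Rplus_le_le_0_compat; apply Rabs_pos).
  assert (Hlow : forall s b, 0 <= s <= 1 -> subdiff f (P s) b -> - C1 <= b (P s) - b z).
  { intros s b Hs Hb. generalize (Hrel _ _ _ (HPA s) Hb).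
    assert (Habs : forall c r, 0 <= c <= 1 -> c * r <= Rabs r /\ - (c * r) <= Rabs r).
    { intros c r Hc. generalize (Rle_abs r) (Rle_abs (- r)) (Rabs_pos r). rewrite Rabs_Ropp.
      intros. split; nra. }
    assert (E : dual_comb X (1 - s) x' s a' (P s) - dual_comb X (1 - s) x' s a' z
                - (zs (P s) - zs z) =
      (1 - s) * (1 - s) * x' x + (1 - s) * s * x' a + (1 - s) * s * a' x + s * s * a' a
      - (1 - s) * x' z - s * a' z - (1 - s) * zs x - s * zs a + 1 * zs z).
    { unfold P; simpl. dual_simpl. ring. }
    generalize (Habs ((1 - s) * (1 - s)) (x' x) ltac:(nra)) (Habs ((1 - s) * s) (x' a) ltac:(nra))
      (Habs ((1 - s) * s) (a' x) ltac:(nra)) (Habs (s * s) (a' a) ltac:(nra))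
      (Habs (1 - s) (x' z) ltac:(lra)) (Habs s (a' z) ltac:(lra))
      (Habs (1 - s) (zs x) ltac:(lra)) (Habs s (zs a) ltac:(lra)) (Habs 1 (zs z) ltac:(lra)).
    unfold C1. lra. }
  (* The constant of [homogeneous_norm_bound] for subgradients along the segment, bounded on the
     ball of radius [e] by [C + (1 + h) / t * C1]. *)
  set (K := 2 * (C + (1 + h) / t * C1) / e).
  assert (Hht : 0 < (1 + h) / t) by (apply Rdiv_lt_0_compat; lra).
  assert (HK : 0 <= K) by (apply Rle_mult_inv_pos; [nra|lra]).
  assert (Hlip : forall s u c, 0 <= s < l -> epi f u c ->
            epi f (P s) (c + K * vnorm X (vsub u (P s)))).
  { intros s u c Hs Hu.
    destruct (subdiff_of_bounded_near X f (P s) Hp Hf (Hin s Hs)) as [b Hb].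
    destruct (HP s ltac:(lra)) as [ts [vs [Hts [Hvs Es]]]].
    assert (Hby : forall y, b y <= K * vnorm X y).
    { apply homogeneous_norm_bound; [assumption|intros; apply dfun_scal|].
      intros y Hy. generalize (Hlow s b ltac:(lra) Hb). rewrite Es in Hb |- *.
      generalize (Hest vs ts y b Hvs ltac:(lra) Hy Hb). set (d := b _ - b z). intros H1 H2.
      assert (Hk : 0 <= (1 + h - ts) / ts <= (1 + h) / t).
      { split; [apply Rle_mult_inv_pos; lra|].
        apply Rmult_le_compat; [lra|left; apply Rinv_0_lt_compat; lra|lra|].
        apply Rinv_le_contravar; lra. }
      assert (- ((1 + h) / t * C1) <= (1 + h - ts) / ts * d) by nra. lra. }
    apply subdiff_epi in Hb; [|assumption]. destruct Hb as [q [Eq Hb]].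
    apply epi_le with q; [now apply epi_self|].
    generalize (Hb u c Hu) (Hby (vsub (P s) u)). rewrite (vnorm_subC X u).
    replace (b (vsub (P s) u)) with (b (P s) - b u) by (dual_simpl; ring). lra. }
  assert (Hlim : forall u c, epi f u c -> epi f (P l) (c + K * vnorm X (vsub u (P l)))).
  { intros u c Hu. apply epi_lsc; [assumption|]. intros d Hd.
    (* The summand [1] controls the distance to [P l], and [K] the change of the cone term. *)
    destruct (small_scale ((1 + K) * vnorm X (vsub a x)) d) as [s [Hs Hsd]];
      [generalize (vnorm_ge0 X (vsub a x)); nra|assumption|].
    exists (P (l * (1 - s))).
    assert (En : vnorm X (vsub (P (l * (1 - s))) (P l)) = l * s * vnorm X (vsub a x)).
    { rewrite vnorm_subC. replace (vsub _ _) with (vscal X (l * s) (vsub a x))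
        by (unfold P; vec).
      apply vnorm_scal_pos; nra. }
    generalize (vnorm_ge0 X (vsub a x)); intro Hax.
    assert (Hls : 0 <= l * s * vnorm X (vsub a x) <= s * vnorm X (vsub a x)).
    { assert (0 <= s * vnorm X (vsub a x)) by nra. split; nra. }
    split; [rewrite En; nra|].
    apply epi_le with (1 := Hlip (l * (1 - s)) u c ltac:(split; nra) Hu).
    generalize (vnorm_sub_triangle X (P l) u (P (l * (1 - s)))).
    rewrite (vnorm_subC X (P l)), En. nra. }
  destruct (bounded_near_epi X f x Hx) as [c0 Hc0].
  destruct (epi_fin X f (P l) _ (Hlim x c0 Hc0)) as [q [Eq _]].
  destruct (subdiff_of_cone_minorant X f (P l) q K Hp Hf Eq HK) as [b Hb].
  { intros u c Hu. destruct (epi_fin X f (P l) _ (Hlim u c Hu)) as [q' [Eq' Hq']].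
    rewrite Eq in Eq'. injection Eq' as <-. lra. }
  destruct (normal_exists X f x (P l) Hf Hx Hout) as [n [Hn Hnx]].
  (* The prolonged point moved slightly along [P l - x] is still in the domain, where [n] is at most
     [n (P l)]. The move itself increases [n], which makes the inequality strict. *)
  assert (Hneg : n (P l) - n z < 0).
  { destruct (HP l ltac:(lra)) as [ts [vs [Hts [Hvs Es]]]].
    destruct (small_scale (vnorm X (vsub (P l) x)) e (vnorm_ge0 X _) He) as [k [Hk Hke]].
    destruct (Hball vs (vscal X k (vsub (P l) x)) Hvs) as [c Hc].
    { rewrite vnorm_scal_pos; lra. }
    generalize (Hn _ _ Hc).
    assert (E : n (vadd X (drop z (1 + h) vs) (vscal X k (vsub (P l) x))) - n (P l) =
                (1 + h - ts) / ts * (n (P l) - n z) + k * (n (P l) - n x)).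
    { rewrite Es at 2 3. rewrite dfun_add, dfun_scal.
      replace (n (vsub (P l) x)) with (n (P l) - n x) by (dual_simpl; ring).
      unfold drop. dual_simpl. field. lra. }
    rewrite E. intro H.
    assert (0 < (1 + h - ts) / ts) by (apply Rdiv_lt_0_compat; lra). nra. }
  set (g := dual_comb X (1 - l) x' l a' (P l) - dual_comb X (1 - l) x' l a' z
            + (b (P l) - b z) - (zs (P l) - zs z)).
  (* Adding [m n] to [b] leaves a subgradient at [P l], since [n] is normal to the domain there. *)
  assert (Hlam : forall m, 0 <= m -> 0 <= g + m * (n (P l) - n z)).
  { intros m Hm.
    assert (Hbm : subdiff f (P l) (dual_comb X 1 b m n)).
    { apply subdiff_epi in Hb; [|assumption]. destruct Hb as [q' [Eq' Hb]].
      apply subdiff_epi; [assumption|]. exists q'; split; [assumption|].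
      intros u c Hu. simpl. generalize (Hb u c Hu) (Hn u c Hu). nra. }
    generalize (Hrel _ _ _ (HPA l) Hbm). unfold g. simpl. lra. }
  generalize (Hlam 0 (Rle_refl 0)); intro Hg0.
  generalize (Hlam ((g + 1) / - (n (P l) - n z)) ltac:(apply Rle_mult_inv_pos; lra)).
  replace ((g + 1) / - (n (P l) - n z) * (n (P l) - n z)) with (- (g + 1)) by (field; lra).
  lra.
Qed.

(** * Membership of [z] in the domain of [A] and splitting of [zs] *)

Lemma related_dom (X : Banach) (A : operator X) (f : X -> ereal) x z (zs : dual X) :
  maximally_monotone A -> linear_relation A -> proper f -> lsc f -> convex f ->
  related A f z zs -> dom_op A x -> bounded_near f x -> dom_op A z.
Proof.
  intros Hmax HA Hp Hlsc Hf Hrel HxA Hx.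
  destruct (drop_bounded_near X A f x z zs HA Hp Hlsc Hf Hrel HxA Hx)
    as [e [h [C [He [Hh [HC [Hslope Hdrop]]]]]]].
  destruct HxA as [x' Hx'].
  set (M := C / h). assert (HM : 0 <= M) by (apply Rle_mult_inv_pos; lra).
  pose (G := fun a (a' : dual X) => a' a - a' z - (zs a - zs z)).
  (* The graph point [a] and the drop point vary independently; difference [0] means that [a] lies
     in the drop, where relatedness and the slope bound give [G a a' + M * t >= 0]. *)
  destruct (linear_minorant X (fun y s => exists a a' t v, A a a' /\ 0 < t <= 1 /\
     vnorm X (vsub v x) < e /\ y = vsub (drop z t v) a /\ G a a' + M * t <= s) e (G x x' + M))
    as [y Hy].
  - assumption.
  - intros u Hu. exists x, x', 1, (vadd X x u).
    repeat split; try lra; [assumption| |unfold drop; vec].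
    now replace (vsub (vadd X x u) x) with u by vec.
  - intros y1 y2 s1 s2 l Hl [a1 [a1' [t1 [v1 [H1 [Ht1 [Hv1 [-> L1]]]]]]]]
      [a2 [a2' [t2 [v2 [H2 [Ht2 [Hv2 [-> L2]]]]]]]].
    destruct (drop_convex X z l t1 v1 t2 v2 Hl Ht1 Ht2) as [Ht [Hk E]].
    eexists _, _, _, _. split; [exact (linear_relation_comb X A l (1 - l) _ _ _ _ HA H1 H2)|].
    split; [exact Ht|]. split; [apply vnorm_convex_lt; [exact Hk|exact Hv1|exact Hv2]|].
    split; [rewrite E; vec|].
    generalize (proj1 Hmax _ _ _ _ H1 H2). unfold G in *. simpl. dual_simpl. intro Hm.
    (* By this amount [G] at the combination falls below the combination of its values. *)
    assert (0 <= l * (1 - l) * (a1' a1 - a1' a2 - a2' a1 + a2' a2)).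
    { apply Rmult_le_pos; nra. }
    apply (Rmult_le_compat_l l) in L1; [|lra].
    apply (Rmult_le_compat_l (1 - l)) in L2; [|lra]. nra.
  - intros s [a [a' [t [v [Ha [Ht [Hv [E L]]]]]]]].
    assert (Ea : a = drop z t v).
    { replace a with (vsub (drop z t v) (vsub (drop z t v) a)) by vec. rewrite <- E. vec. }
    subst a.
    destruct (subdiff_of_bounded_near X f (drop z t v) Hp Hf) as [b Hb].
    { apply Hdrop; [assumption..|now exists a']. }
    generalize (Hrel _ _ _ Ha Hb) (Hslope v t b Hv Ht Hb). unfold G, M in *.
    replace (C * t / h) with (C / h * t) by (field; lra). lra.
  (* The value at [z] is [zs - y]: as [t] tends to [0] the drop points tend to [z], leaving
     [y z - y a <= G a a']. *)
  - exists (dual_comb X 1 zs (-1) y). apply maximally_monotone_mem; [assumption|].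
    intros a a' Ha. simpl.
    assert (y z - y a - G a a' <= 0); [|unfold G in *; lra].
    apply nonpos_of_le_scale with (M - (y x - y z)). intros t Ht.
    assert (H : y (vsub (drop z t x) a) <= G a a' + M * t).
    { apply Hy. exists a, a', t, x. repeat split; try lra; [assumption|].
      replace (vsub x x) with (vzero X) by vec. now rewrite vnorm_0. }
    replace (y (vsub (drop z t x) a)) with (t * y x + (1 - t) * y z - y a) in H
      by (unfold drop; dual_simpl; ring). lra.
Qed.

(** So [z] minimizes [f - (zs - z')] over [dom A]. For [u] interior to the domain of [f], test
    relatedness at [drop z t u] and let [t] tend to [0]; a general [u] is approached along the
    segment from [x]. *)
Lemma related_minimizes (X : Banach) (A : operator X) (f : X -> ereal) x z (zs z' : dual X) :
  linear_relation A -> proper f -> lsc f -> convex f -> related A f z zs ->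
  A z z' -> dom_op A x -> bounded_near f x ->
  forall u c, dom_op A u -> epi f u c -> epi f z (c - ((zs u - zs z) - (z' u - z' z))).
Proof.
  intros HA Hp Hlsc Hf Hrel Hz HxA Hx.
  assert (Hint : forall u c, dom_op A u -> bounded_near f u -> epi f u c ->
            epi f z (c - ((zs u - zs z) - (z' u - z' z)))).
  { intros u c HuA Hub Hu. pose proof HuA as [u' Hu'].
    destruct (drop_bounded_near X A f u z zs HA Hp Hlsc Hf Hrel HuA Hub)
      as [e [h [C [He [_ [_ [_ Hdrop]]]]]]].
    set (Q := (zs u - zs z) - (z' u - z' z)).
    set (S := (u' u - u' z) - (z' u - z' z)).
    apply epi_lsc; [assumption|]. intros d Hd.
    destruct (small_scale (vnorm X (vsub u z) + Rabs Q + 2 * Rabs S) d) as [t [Ht Htd]];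
      [generalize (vnorm_ge0 X (vsub u z)) (Rabs_pos Q) (Rabs_pos S); lra|assumption|].
    generalize (vnorm_ge0 X (vsub u z)) (Rabs_pos Q) (Rabs_pos S); intros HN HQ HS.
    exists (drop z t u). split.
    { replace (vsub (drop z t u) z) with (vscal X t (vsub u z)) by (unfold drop; vec).
      rewrite vnorm_scal_pos by lra. nra. }
    assert (HtA : A (drop z t u) (dual_comb X t u' (1 - t) z'))
      by exact (linear_relation_comb X A t (1 - t) _ _ _ _ HA Hu' Hz).
    destruct (subdiff_of_bounded_near X f (drop z t u) Hp Hf) as [b Hb].
    { apply Hdrop; [|lra|now eexists; apply HtA].
      replace (vsub u u) with (vzero X) by vec. now rewrite vnorm_0. }
    generalize (Hrel _ _ _ HtA Hb). intro H.
    apply subdiff_epi in Hb; [|assumption]. destruct Hb as [q [Eq Hb]].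
    apply epi_le with q; [now apply epi_self|]. specialize (Hb u c Hu).
    assert (H' : 0 <= t * (t * S - Q + (b u - b z))).
    { unfold S, Q. simpl in H. unfold drop in H. dual_simpl. nra. }
    (* Dividing by [t] bounds [b u - b z] below by [Q - t * S]; the subgradient inequality at [u]
       then eliminates [b]. *)
    assert (H'' : 0 <= t * S - Q + (b u - b z)) by nra.
    replace (b u - b (drop z t u)) with ((1 - t) * (b u - b z)) in Hb
      by (unfold drop; dual_simpl; ring).
    assert (q <= c - (1 - t) * (Q - t * S)) by nra.
    generalize (Rle_abs Q) (Rle_abs S) (Rle_abs (- S)). rewrite Rabs_Ropp. intros.
    assert (t * Q <= t * Rabs Q) by nra. assert ((1 - t) * S <= Rabs S) by nra.
    assert (t * ((1 - t) * S) <= t * Rabs S) by (apply Rmult_le_compat_l; lra).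
    assert (0 <= t * vnorm X (vsub u z)) by nra. assert (0 <= t * Rabs S) by nra.
    nra. }
  intros u c HuA Hu. destruct (bounded_near_epi X f x Hx) as [c0 Hc0].
  pose proof HuA as [u' Hu']. destruct HxA as [x' Hx'].
  set (Q := fun y => (zs y - zs z) - (z' y - z' z)).
  assert (Hseg : forall t, 0 < t < 1 ->
            epi f z (c - Q u + t * ((c0 - Q x) - (c - Q u)))).
  { intros t Ht.
    replace (c - Q u + t * ((c0 - Q x) - (c - Q u))) with
      (t * c0 + (1 - t) * c - Q (vadd X (vscal X t x) (vscal X (1 - t) u)))
      by (unfold Q; dual_simpl; ring).
    apply Hint.
    - eexists. apply (linear_relation_comb X A t (1 - t) x x' u u'); assumption.
    - apply bounded_near_segment with c; auto; lra.
    - apply epi_convex; auto; lra. }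
  destruct (epi_fin X f z _ (Hseg (1 / 2) ltac:(lra))) as [p [Ep _]].
  apply epi_le with p; [now apply epi_self|]. fold (Q u).
  assert (p - (c - Q u) <= 0); [|lra].
  apply nonpos_of_le_scale with ((c0 - Q x) - (c - Q u)). intros t Ht.
  destruct (epi_fin X f z _ (Hseg t Ht)) as [p' [Ep' Hp']].
  rewrite Ep in Ep'. injection Ep' as <-. lra.
Qed.

(** A functional [y] separates the epigraph of [f - (zs - z')] from the subspace [dom A]. Being
    constant on [dom A], it can be moved between the summands: [zs = (z' - y) + (zs - z' + y)]. *)
Lemma related_op_sum (X : Banach) (A : operator X) (f : X -> ereal) x z (zs : dual X) :
  maximally_monotone A -> linear_relation A -> proper f -> lsc f -> convex f ->
  related A f z zs -> dom_op A x -> bounded_near f x -> op_sum A (subdiff f) z zs.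
Proof.
  intros Hmax HA Hp Hlsc Hf Hrel HxA Hx.
  destruct (related_dom X A f x z zs Hmax HA Hp Hlsc Hf Hrel HxA Hx) as [z' Hz].
  generalize (related_minimizes X A f x z zs z' HA Hp Hlsc Hf Hrel Hz HxA Hx). intro Hmin.
  destruct (bounded_near_epi X f x Hx) as [c0 Hc0].
  destruct (epi_fin X f z _ (Hmin x c0 HxA Hc0)) as [p [Ep _]].
  destruct HxA as [x' Hx']. pose proof Hx as [r [C [Hr HC]]].
  set (Q := fun y => (zs y - zs z) - (z' y - z' z)).
  (* Supplies the upper bound on a ball that [linear_minorant] needs. *)
  assert (HQ : exists N, 0 <= N /\ forall y, vnorm X (vsub y x) < r -> - Q y <= N).
  { destruct (dfun_bounded (dual_comb X 1 zs (-1) z')) as [N HN].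
    exists (Rabs (Q x) + Rabs N * r).
    split; [generalize (Rabs_pos (Q x)) (Rabs_pos N); nra|]. intros y Hy.
    generalize (HN (vsub y x)) (Rle_abs (- Q x)) (Rle_abs N) (vnorm_ge0 X (vsub y x)) (Rabs_pos N).
    rewrite Rabs_Ropp. intros H1 H2 H3 H4 H5. apply Rabs_le_inv in H1.
    replace (dual_comb X 1 zs (-1) z' (vsub y x)) with (Q y - Q x) in H1
      by (unfold Q; simpl; dual_simpl; ring).
    assert (N * vnorm X (vsub y x) <= Rabs N * r) by nra. lra. }
  destruct HQ as [N [HN HQ]].
  destruct (linear_minorant X (fun y s => exists a a' u c, A a a' /\ epi f u c /\
     y = vsub u a /\ c - p - Q u <= s) r (C - p + N)) as [y Hy].
  - assumption.
  - intros u Hu. exists x, x', (vadd X x u), C.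
    assert (E : vsub (vadd X x u) x = u) by vec.
    split; [assumption|split; [apply HC; now rewrite E|split; [now rewrite E|]]].
    generalize (HQ (vadd X x u)). rewrite E. intro H; specialize (H Hu). lra.
  - intros y1 y2 s1 s2 l Hl [a1 [a1' [u1 [c1 [H1 [Hu1 [-> L1]]]]]]]
      [a2 [a2' [u2 [c2 [H2 [Hu2 [-> L2]]]]]]].
    eexists _, _, _, _. split; [exact (linear_relation_comb X A l (1 - l) _ _ _ _ HA H1 H2)|].
    split; [apply (epi_convex X f u1 u2 c1 c2 l); auto; lra|]. split; [vec|].
    unfold Q in *. dual_simpl.
    apply (Rmult_le_compat_l l) in L1; [|lra].
    apply (Rmult_le_compat_l (1 - l)) in L2; [|lra]. nra.
  - intros s [a [a' [u [c [Ha [Hu [E L]]]]]]].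
    assert (Ea : u = a).
    { replace u with (vadd X (vsub u a) a) by vec. rewrite <- E. vec. }
    subst u. destruct (epi_fin X f z _ (Hmin a c (ex_intro _ a' Ha) Hu)) as [p' [Ep' Hp']].
    rewrite Ep in Ep'. injection Ep' as <-. unfold Q in L. lra.
  - assert (Hyu : forall a a' u c, A a a' -> epi f u c -> y u - y a <= c - p - Q u).
    { intros a a' u c Ha Hu.
      replace (y u - y a) with (y (vsub u a)) by (dual_simpl; ring).
      apply Hy. exists a, a', u, c. repeat split; try assumption. lra. }
    assert (HyA : forall a a', A a a' -> y a - y z = 0).
    { assert (Hge : forall a a', A a a' -> 0 <= y a - y z).
      { intros a a' Ha. generalize (Hyu a a' z p Ha (epi_self X f z p Ep)). unfold Q. lra. }
      intros a a' Ha. apply Rle_antisym; [|eauto].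
      (* The reflection [2 z - a] is again in [dom A] and gives the opposite inequality. *)
      generalize (Hge _ _ (linear_relation_comb X A (-1) 2 _ _ _ _ HA Ha Hz)).
      dual_simpl. lra. }
    exists (dual_comb X 1 z' (-1) y), (dual_comb X 1 zs 1 (dual_comb X (-1) z' 1 y)).
    split; [|split].
    + apply maximally_monotone_mem; [assumption|]. intros a a' Ha.
      generalize (HyA a a' Ha) (proj1 Hmax _ _ _ _ Ha Hz). simpl. dual_simpl. lra.
    + apply subdiff_epi; [assumption|]. exists p; split; [assumption|]. intros u c Hu.
      generalize (Hyu z z' u c Hz Hu). unfold Q. simpl. lra.
    + intro u. simpl. ring.
Qed.

Lemma subdiff_monotone (X : Banach) (f : X -> ereal) : proper f -> monotone (subdiff f).
Proof.
  intros Hp x xs y ys Hx Hy. apply subdiff_epi in Hx, Hy; try assumption.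
  destruct Hx as [p [Ep Hx]], Hy as [q [Eq Hy]].
  generalize (Hx y q (epi_self X f y q Eq)) (Hy x p (epi_self X f x p Ep)). dual_simpl. lra.
Qed.

Theorem theorem3p1 (X : Banach) (A : operator X) (f : X -> ereal) :
  maximally_monotone A -> linear_relation A ->
  proper f -> lsc f -> convex f ->
  (exists x, dom_op A x /\ norm_interior (dom_op (subdiff f)) x) ->
  maximally_monotone (op_sum A (subdiff f)).
Proof.
  intros Hmax HA Hp Hlsc Hf [x [HxA [d [Hd Hdom]]]]. split.
  - intros u us v vs [a [b [Ha [Hb Eu]]]] [a2 [b2 [Ha2 [Hb2 Ev]]]].
    generalize (proj1 Hmax _ _ _ _ Ha Ha2) (subdiff_monotone X f Hp _ _ _ _ Hb Hb2).
    unfold pairing. rewrite Eu, Ev. lra.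
  - intros B HB Hext z zs Hz. apply related_op_sum with x; auto.
    + intros a a' b Ha Hb.
      assert (Hab : op_sum A (subdiff f) a (dual_comb X 1 a' 1 b)).
      { exists a', b. split; [assumption|split; [assumption|]]. intro u; simpl; ring. }
      generalize (HB _ _ _ _ (Hext _ _ Hab) Hz). simpl. dual_simpl. lra.
    (* Subgradients exist only where [f] is finite, so the interior of [dom (subdiff f)] lies in
       that of [dom f]. *)
    + apply bounded_near_interior; auto. exists d; split; [assumption|].
      intros u Hu. destruct (Hdom u Hu) as [b Hb]. apply subdiff_epi in Hb; [|assumption].
      destruct Hb as [p [Ep _]]. exists p. now apply epi_self.
Qed.
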